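(* Let $n\ge1$. If $b\in\Delta_n=\{1,2,4,7\}^n$ and $b\ne e_n$, where $e_n=77\cdots7$ is the identity word, then the centralizer $C_{\mathcal F_n}(b)=\{h\in\mathcal F_n:hb=bh\}$ has cardinality $$|C_{\mathcal F_n}(b)|=4^n.$$
   Context: Digits are identified with quaternionic symbols: $1=i$, $2=j$, $4=k$, $7=e$, where $e$ is the identity, $i^2=j^2=k^2=-e$, $ij=k=-ji$, $jk=i=-kj$, $ki=j=-ik$. Words are multiplied coordinate by coordinate, with the local quaternionic signs collected into one global sign. $\mathcal F_n=\{\pm b:b\in\Delta_n\}$ is the resulting signed group, of order $2\cdot4^n$ (the central product of $n$ copies of the quaternion group $Q_8$). *)

(* Defs.v *)
From HB Require Import structures.
From mathcomp Require Import all_boot all_fingroup.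

Set Implicit Arguments.
Unset Strict Implicit.
Unset Printing Implicit Defensive.

(* D1, D2, D4, D7 are the digits 1, 2, 4, 7, i.e. the quaternion symbols
   i, j, k, e, where e is the identity. *)
Variant digit : predArgType := D1 | D2 | D4 | D7.

Definition digit_val (d : digit) : nat :=
  match d with D1 => 1 | D2 => 2 | D4 => 4 | D7 => 7 end.

Definition digit_of (m : nat) : digit :=
  match m with 1 => D1 | 2 => D2 | 4 => D4 | _ => D7 end.

Lemma digit_valK : cancel digit_val digit_of.
Proof. by case. Qed.

HB.instance Definition _ := Countable.copy digit (can_type digit_valK).

Lemma digit_enumP : Finite.axiom [:: D1; D2; D4; D7].
Proof. by case. Qed.

HB.instance Definition _ := isFinite.Build digit digit_enumP.

(* The pair (b, c) stands for (-1)^b c: the quaternion product x y. *)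
Definition quat_mul (x y : digit) : bool * digit :=
  match x, y with
  | D7, _ => (false, y)
  | _, D7 => (false, x)
  | D1, D1 | D2, D2 | D4, D4 => (true, D7)
  | D1, D2 => (false, D4)
  | D2, D1 => (true, D4)
  | D2, D4 => (false, D1)
  | D4, D2 => (true, D1)
  | D4, D1 => (false, D2)
  | D1, D4 => (true, D2)
  end.

Notation Delta n := {ffun 'I_n -> digit}.

Definition identity_word (n : nat) : Delta n := [ffun=> D7].

(* SignedWord true b stands for - b. *)
Record signed_word (n : nat) : predArgType :=
  SignedWord { negative : bool; word_of : Delta n }.

Section SignedGroup.
Variable n : nat.
Implicit Types x y z : signed_word n.

Definition signed_word_pair x : bool * Delta n := (negative x, word_of x).
Definition pair_signed_word (p : bool * Delta n) : signed_word n :=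
  SignedWord p.1 p.2.

Lemma signed_word_pairK : cancel signed_word_pair pair_signed_word.
Proof. by case. Qed.

HB.instance Definition _ :=
  Finite.copy (signed_word n) (can_type signed_word_pairK).

Definition signed_mul x y : signed_word n :=
  SignedWord
    (negative x (+) negative y
      (+) \big[addb/false]_(i < n) (quat_mul (word_of x i) (word_of y i)).1)
    [ffun i => (quat_mul (word_of x i) (word_of y i)).2].

Definition signed_one : signed_word n := SignedWord false (identity_word n).

Definition signed_inv x : signed_word n :=
  SignedWord
    (negative x
      (+) \big[addb/false]_(i < n) (quat_mul (word_of x i) (word_of x i)).1)
    (word_of x).

Lemma signed_mulA : associative signed_mul.
Proof.
move=> [a u] [b v] [c w]; congr SignedWord => /=; last first.
  by apply/ffunP=> i; rewrite !ffunE; case: (u i) (v i) (w i) => [] [] [].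
pose s (f : 'I_n -> bool) := \big[addb/false]_(i < n) f i.
have sD f g : s f (+) s g = s (fun i => f i (+) g i) by rewrite /s big_split.
rewrite -!/(s _).
have : s (fun i => (quat_mul (v i) (w i)).1)
    (+) s (fun i => (quat_mul (u i) ([ffun i => (quat_mul (v i) (w i)).2] i)).1)
  = s (fun i => (quat_mul (u i) (v i)).1)
    (+) s (fun i => (quat_mul ([ffun i => (quat_mul (u i) (v i)).2] i) (w i)).1).
  rewrite !sD; apply: eq_bigr => i _; rewrite !ffunE.
  by case: (u i) (v i) (w i) => [] [] [].
by case: a b c (s _) (s _) (s _) (s _) => [] [] [] [] [] [] [].
Qed.

Lemma signed_mul1 : left_id signed_one signed_mul.
Proof.
move=> [b v]; congr SignedWord => /=; last by apply/ffunP=> i; rewrite !ffunE.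
by rewrite big1 ?addbF // => i _; rewrite ffunE.
Qed.

Lemma signed_mulV : left_inverse signed_one signed_inv signed_mul.
Proof.
move=> [b v]; congr SignedWord => /=.
  by rewrite [b (+) _]addbC addbK addbb.
by apply/ffunP=> i; rewrite !ffunE; case: (v i).
Qed.

HB.instance Definition _ :=
  Finite_isGroup.Build (signed_word n) signed_mulA signed_mul1 signed_mulV.

Definition signed_group : {group signed_word n} := [set: signed_word n]%G.

Lemma card_signed_group : #|signed_group| = 2 * 4 ^ n.
Proof.
rewrite cardsT -[RHS](_ : #|{: bool * Delta n}| = _); last first.
  rewrite card_prod card_bool card_ffun card_ord.
  by rewrite (_ : #|{: digit}| = 4) // cardE enumT unlock.
apply: (bij_eq_card (f := signed_word_pair)).
by exists pair_signed_word; [exact: signed_word_pairK | case].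
Qed.

End SignedGroup.

Definition pos_word (n : nat) (b : Delta n) : signed_word n :=
  SignedWord false b.

(* Main.v *)
(** Two signed words commute up to the sign [comm_sign], which is additive in
    each argument.  If [b i] is not the identity digit, some digit
    anticommutes with it, and the word [w] having that digit at [i] and the
    identity elsewhere anticommutes with [b].  Multiplication by [w] then
    exchanges the centralizer of [b] with its complement, so the centralizer
    contains exactly half of the [2 * 4 ^ n] signed words. *)
Require Import Defs.
From mathcomp Require Import all_boot all_fingroup.

Definition comm_sign (n : nat) (u v : Delta n) : bool :=
  \big[addb/false]_(i < n) ((quat_mul (u i) (v i)).1 (+) (quat_mul (v i) (u i)).1).

(** Digits commute up to sign, so [x * y] and [y * x] have the same word and can differ only in
    their global sign. *)
Lemma commute_signedE (n : nat) (x y : signed_word n) :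
  (x * y == y * x)%g = ~~ comm_sign n (word_of x) (word_of y).
Proof.
have word_mulC : word_of (x * y)%g = word_of (y * x)%g.
  by apply/ffunP=> i; rewrite !ffunE; case: (word_of x i) (word_of y i) => [] [].
have -> : (x * y == y * x)%g = (negative (x * y)%g == negative (y * x)%g).
  apply/eqP/eqP => [-> //|]; move: word_mulC.
  by case: (x * y)%g (y * x)%g => [? ?] [? ?] /= -> ->.
rewrite /comm_sign big_split /= [negative y (+) _]addbC.
by case: (negative x (+) negative y) (\big[_/_]_(i < n) _) (\big[_/_]_(i < n) _)
  => [] [] [].
Qed.

(** Commutators of quaternion symbols are central signs, hence multiplicative in each coordinate. *)
Lemma comm_signM (n : nat) (x y : signed_word n) (v : Delta n) :
  comm_sign n (word_of (x * y)%g) v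
    = comm_sign n (word_of x) v (+) comm_sign n (word_of y) v.
Proof.
rewrite /comm_sign -big_split; apply: eq_bigr => i _; rewrite ffunE.
by case: (word_of x i) (word_of y i) (v i) => [] [] [].
Qed.

Lemma exists_anticommuting_digit (d : digit) : d != D7 ->
  exists c, (quat_mul c d).1 (+) (quat_mul d c).1.
Proof. by case: d => // _; [exists D2 | exists D1 | exists D1]. Qed.

Lemma exists_anticommuting_word (n : nat) (b : Delta n) :
  b <> identity_word n -> exists w, comm_sign n w b.
Proof.
move=> bN1; have [i bi] : exists i, b i != D7.
  apply/existsP; apply: contra_notT bN1 => /existsPn b1.
  by apply/ffunP=> i; rewrite ffunE; apply/eqP/negbNE.
have [c cP] := exists_anticommuting_digit _ bi.
exists [ffun j => if j == i then c else D7].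
rewrite /comm_sign (bigD1 i) //= big1 => [|j /negPf ji].
  by rewrite addbF ffunE eqxx.
by rewrite ffunE ji; case: (b j).
Qed.

Theorem theorem6p3 (n : nat) (hn : 0 < n) (b : Delta n)
    (hb : b <> identity_word n) :
  #|('C_(signed_group n)[pos_word b])%g| = 4 ^ n.
Proof.
have [w wb] := exists_anticommuting_word _ _ hb.
set C := ('C_(signed_group n)[pos_word b])%g.
have inC x : (x \in C) = ~~ comm_sign n (word_of x) b.
  by rewrite inE in_setT cent1E commute_signedE.
have CN : ( *%g^~ (pos_word w) @^-1: ~: C)%g = C.
  by apply/setP=> x; rewrite [LHS]inE in_setC !inC comm_signM wb addbT negbK.
have cardC : #|C| = #|~: C|.
  by rewrite -{1}CN card_preimset //; exact: mulIg.
(* After doubling, one copy of [#|C|] becomes [#|~: C|], and the sum is the group order. *)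
apply/double_inj; rewrite -addnn {2}cardC cardsC -cardsT.
by rewrite -[[set: _]]/(signed_group n : {set _}) card_signed_group mul2n.
Qed.
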